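(* Let $\mathbf{X},\mathbf{Y},\mathbf{Z}$ be finite non-empty sets, $N\ge1$ fixed, and let $(X_n,Y_n,Z_n)$, $n=1,\dots,N$, be random elements of $\mathbf{X}\times\mathbf{Y}\times\mathbf{Z}$ on a common probability space. Suppose there are a probability distribution $\pi$ on $\mathbf{Z}$ and probability distributions $q(\cdot\mid x,z)$ on $\mathbf{Y}$, $(x,z)\in\mathbf{X}\times\mathbf{Z}$, such that for every $n\in[N]$, writing $\mathcal{H}_{n-1}:=\sigma\bigl((X_i,Y_i,Z_i):i<n\bigr)$: (i) conditionally on $\mathcal{H}_{n-1}$, $Z_n$ has distribution $\pi$; (ii) the conditional distribution of $X_n$ given $\mathcal{H}_{n-1}$ and $Z_n$ is arbitrary; (iii) conditionally on $\sigma(\mathcal{H}_{n-1},Z_n,X_n)$, $Y_n$ has distribution $q(\cdot\mid X_n,Z_n)$. Fix $\delta>0$, $\tilde x\in\mathbf{X}$, $y\in\mathbf{Y}$, and let $P(y\mid\mathrm{do}(\tilde x)):=\sum_{z\in\mathbf{Z}}q(y\mid\tilde x,z)\pi(z)$. Let \[ m:=\sum_{z\in\mathbf{Z}}\hat p(z)\,\check p(y\mid\tilde x,z),\qquad h:=|\mathbf{Z}|\sqrt{\frac{\ln\frac{4|\mathbf{Z}|}{\delta}}{2N}}+\sum_{z\in\mathbf{Z}}\sqrt{\frac{2\ln\log_2\lfloor\!\lfloor\#\tilde x z\rfloor\!\rfloor+\ln\frac{6.6|\mathbf{Z}|}{\delta}}{2\lfloor\!\lfloor\#\tilde x z\rfloor\!\rfloor}},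 \] with the convention $\ln\log_2 1:=\infty$ (so $h=\infty$ unless $\#\tilde x z\ge2$ for all $z$). Then $\mathbb{P}\bigl(P(y\mid\mathrm{do}(\tilde x))\in[m-h,m+h]\bigr)\ge1-\delta$.
   Context: This models the ''strong interpretation'' of a repeated causal diagram in which $Z$ satisfies the back-door criterion relative to $(X,Y)$: $X_n$ is a decision that may depend on all past observations. Notation: for $m\le N$, $\#_m \tilde x z:=|\{n\in[m]:(X_n,Z_n)=(\tilde x,z)\}|$, $\#\tilde x z:=\#_N\tilde x z$, $\#z:=|\{n\in[N]:Z_n=z\}|$, $\hat p(z):=\#z/N$. For an integer $n\ge2$, $\lfloor\!\lfloor n\rfloor\!\rfloor$ is the largest number of the form $2^k$, $k\in\{1,2,\dots\}$, with $2^k\le n$; for $n<2$, $\lfloor\!\lfloor n\rfloor\!\rfloor:=1$. The estimate \[ \check p(y\mid\tilde x,z):=\frac{|\{n\in[N]:\#_n\tilde x z\le\lfloor\!\lfloor\#\tilde x z\rfloor\!\rfloor,\ X_n=\tilde x,\ Y_n=y,\ Z_n=z\}|}{\lfloor\!\lfloor\#\tilde x z\rfloor\!\rfloor} \] is the fraction of the first $\lfloor\!\lfloor\#\tilde x z\rfloor\!\rfloor$ observations with $(X_n,Z_n)=(\tilde x,z)$ for which $Y_n=y$ (its value is irrelevant when $h=\infty$). *)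

(* Defs.v *)
From HB Require Import structures.
From mathcomp Require Import all_boot all_order all_algebra.
From mathcomp Require Import all_classical all_reals all_analysis.
Set Implicit Arguments. Unset Strict Implicit. Unset Printing Implicit Defensive.
Import Order.TTheory GRing.Theory Num.Theory.
Local Open Scope ring_scope.

(* Time indices are 0-based: index i < N corresponds to the paper's n = i+1. *)

Definition dfloor (n : nat) : nat :=
  if (n < 2)%N then 1%N else (2 ^ trunc_log 2 n)%N.

Section Counts.
Variables (T : Type) (Xt Yt Zt : eqType).
Variables (X : nat -> T -> Xt) (Y : nat -> T -> Yt) (Z : nat -> T -> Zt).

Definition hist (n : nat) (w : T) : seq (Xt * Yt * Zt) :=
  [seq (X i w, Y i w, Z i w) | i <- iota 0 n].

Definition cntXZ (m : nat) (x : Xt) (z : Zt) (w : T) : nat :=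
  count (fun i => (X i w == x) && (Z i w == z)) (iota 0 m).

Definition cntZ (N : nat) (z : Zt) (w : T) : nat :=
  count (fun i => Z i w == z) (iota 0 N).
End Counts.

Section Estimates.
Variables (R : realType) (T : Type) (Xt Yt : eqType) (Zt : finType).
Variables (X : nat -> T -> Xt) (Y : nat -> T -> Yt) (Z : nat -> T -> Zt).
Variable (N : nat).

Definition phat (z : Zt) (w : T) : R := (cntZ Z N z w)%:R / N%:R.

Definition pcheck (y : Yt) (x : Xt) (z : Zt) (w : T) : R :=
  let F := dfloor (cntXZ X Z N x z w) in
  (count (fun i => [&& (cntXZ X Z i.+1 x z w <= F)%N, X i w == x,
                       Y i w == y & Z i w == z]) (iota 0 N))%:R / F%:R.

Definition m_est (y : Yt) (x : Xt) (w : T) : R :=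
  \sum_(z : Zt) phat z w * pcheck y x z w.

(* h, in the case where #x z >= 2 for all z (otherwise h = +oo) *)
Definition h_est (delta : R) (x : Xt) (w : T) : R :=
  #|Zt|%:R * Num.sqrt (ln (4 * #|Zt|%:R / delta) / (2 * N%:R)) +
  \sum_(z : Zt)
    let F : R := (dfloor (cntXZ X Z N x z w))%:R in
    Num.sqrt ((2 * ln (ln F / ln 2) + ln ((66 / 10) * #|Zt|%:R / delta))
              / (2 * F)).

(* the event  P(y | do(x)) \in [m - h, m + h]  (true when h = +oo) *)
Definition covered (delta : R) (Pdo : R) (y : Yt) (x : Xt) (w : T) : Prop :=
  (forall z : Zt, (2 <= cntXZ X Z N x z w)%N) ->
  m_est y x w - h_est delta x w <= Pdo <= m_est y x w + h_est delta x w.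
End Estimates.

(* Main.v *)
Require Import Defs.
From HB Require Import structures.
From mathcomp Require Import all_boot all_order all_algebra.
From mathcomp Require Import all_classical all_reals all_analysis.
From mathcomp Require Import ring lra zify.
Set Implicit Arguments. Unset Strict Implicit. Unset Printing Implicit Defensive.
Import Order.TTheory GRing.Theory Num.Theory.
Local Open Scope classical_set_scope.
Local Open Scope ring_scope.

(* Writing [phat * pcheck - pi * q = (phat - pi) * q + phat * (pcheck - q)], it
   suffices to control [phat - pi] and [pcheck - q] for every [z].

   Both are deviations of a frequency of successes among trials selected by a
   predictable rule: all times for [phat], the first [F] visits to [(x, z)] for
   [pcheck]. If [C] trials are selected up to time [n], with [K] successes of
   conditional probability [p], then [exp (s (K - p C) - s^2 C / 8)] is a
   supermartingale by Hoeffding's lemma, so on the event [C = F] the usual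
   bound [2 exp (- 2 F t^2)] holds whatever the strategy choosing [X_n].

   The random number of visits is handled by a union bound over the powers of
   two [F = 2^k], with failure probability proportional to [1 / k^2]; since
   [\sum_k 1 / k^2 <= 33 / 20] these failures cost [delta / 2] in total, and the
   deviations of [phat] cost the other [delta / 2]. *)

(** * Hoeffding's lemma for a centred Bernoulli variable *)

Section BernoulliMgf.
Import numFieldNormedType.Exports.
Variable R : realType.
Implicit Types s p : R.

Lemma is_derive_nonneg_ge (f df : R -> R) (s : R) : 0 <= s ->
  (forall x : R, is_derive x 1 f (df x)) -> (forall x, 0 <= x -> 0 <= df x) ->
  f 0 <= f s.
Proof.
move=> s0 fdf df0.
have cf : {within `[0, s], continuous f}.
  apply: continuous_subspaceT => x; apply: differentiable_continuous.
  by apply/derivable1_diffP; have [] := fdf x.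
have [c] := MVT_segment s0 (fun x _ => fdf x) cf.
rewrite in_itv/= => /andP[c0 _]; rewrite subr0 -subr_ge0 => ->.
by rewrite mulr_ge0 ?df0.
Qed.

Lemma logistic_mix_gt0 p s : 0 <= p <= 1 -> 0 < 1 - p + p * expR s.
Proof.
move=> /andP[p0 p1]; have e0 := expR_gt0 s.
have [->|pn0] := eqVneq p 0; first by rewrite mul0r; lra.
have : 0 < p * expR s by rewrite mulr_gt0// lt_neqAle eq_sym pn0.
lra.
Qed.

Lemma is_derive_logistic_mix p s :
  is_derive s 1 (fun s => 1 - p + p * expR s) (p * expR s).
Proof.
have := is_deriveD (is_derive_cst (1-p) s 1) (is_deriveZ p (is_derive_expR s)).
by rewrite add0r.
Qed.

(** The logarithmic derivative u = p e^s / D(s) of D(s) = 1 - p + p e^s is a logistic function: it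
    equals p at 0, and its slope u (1 - u) never exceeds 1/4. *)
Lemma logistic_le p s : 0 <= p <= 1 -> 0 <= s ->
  p * expR s <= (1 - p + p * expR s) * (s / 4 + p).
Proof.
move=> p01 s0.
pose D (s : R) : R := 1 - p + p * expR s.
have D0 x : 0 < D x by exact: logistic_mix_gt0.
(* Since (1 - p) / D is 1 minus the logistic function, the slope bound says that [K] is
   nondecreasing. *)
pose K (x : R) := (4^-1 * x) + (1 - p) * (D x)^-1.
pose dK x := 4^-1 - (1 - p) * (p * expR x) / (D x) ^+ 2.
have KdK (x : R) : is_derive x 1 K (dK x).
  have h1 : is_derive x 1 (fun x => (D x)^-1) (- D x ^- 2 *: (p * expR x)).
    by apply: is_deriveV; rewrite ?gt_eqF//; exact: is_derive_logistic_mix.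
  have := is_deriveD (is_deriveZ 4^-1 (is_derive_id x 1)) (is_deriveZ (1 - p) h1).
  move=> /is_derive_eq; apply; rewrite /dK /GRing.scale /=; ring.
have dK0 x : 0 <= x -> 0 <= dK x.
  move=> _; rewrite subr_ge0 ler_pdivrMr ?exprn_gt0//.
  (* This is 4 u v <= (u + v)^2 with u = 1 - p and v = p e^x. *)
  rewrite /D; have := sqr_ge0 (1 - p - p * expR x); nra.
have := is_derive_nonneg_ge s0 KdK dK0.
rewrite /K /D expR0 mulr0 add0r mulr1 subrK invr1 mulr1 -/(D s) => h.
have : D s * (1 - p) <= D s * (4^-1 * s + (1 - p) / D s) by rewrite ler_pM2l.
rewrite (_ : D s * (_ + _ / _) = D s * s / 4 + (1 - p)); last first.
  by field; rewrite gt_eqF.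
rewrite /D; lra.
Qed.

(** Divided by the right-hand side, the left-hand side becomes D(s) exp(-(s^2/8 + p s)) with D(s) =
    1 - p + p e^s. This is 1 at 0 and nonincreasing for s >= 0, its derivative having the sign given
    by [logistic_le]. *)
Lemma bernoulli_mgf_pos p s : 0 <= p <= 1 -> 0 <= s ->
  p * expR (s * (1 - p)) + (1 - p) * expR (- (s * p)) <= expR (s ^+ 2 / 8).
Proof.
move=> p01 s0.
pose D (s : R) : R := 1 - p + p * expR s.
pose E (x : R) := expR (- (8^-1 * x ^+ 2 + p * x)).
pose G (x : R) := - (D x * E x).
pose dG x := E x * (D x * (x / 4 + p) - p * expR x).
have GdG (x : R) : is_derive x 1 G (dG x).
  have h1 : is_derive x 1 (fun x => - (8^-1 * x ^+ 2 + p * x)) (- (x / 4 + p)).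
    have := is_deriveN (is_deriveD
      (is_deriveZ 8^-1 (is_deriveX 2 (is_derive_id x 1))) (is_deriveZ p (is_derive_id x 1))).
    move=> /is_derive_eq; apply; rewrite /GRing.scale /= expr1; lra.
  have h2 := @is_derive1_comp _ expR (fun x => - (8^-1 * x ^+ 2 + p * x)) x _ _
    (is_derive_expR _) h1.
  have := is_deriveN (is_deriveM (is_derive_logistic_mix p x) h2).
  move=> /is_derive_eq; apply; rewrite /dG /E/D /GRing.scale /=; ring.
have dG0 x : 0 <= x -> 0 <= dG x.
  by move=> x0; rewrite mulr_ge0 ?expR_ge0// subr_ge0 logistic_le.
have := is_derive_nonneg_ge s0 GdG dG0.
rewrite /G lerN2 /D /E expr0n/= !mulr0 addr0 oppr0 expR0 !mulr1 subrK.
move=> h.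
have -> : p * expR (s * (1 - p)) + (1 - p) * expR (- (s * p)) =
    (1 - p + p * expR s) * expR (- (p * s)).
  rewrite (mulrC s p) (_ : s * (1 - p) = s + - (p * s)); last by ring.
  by rewrite expRD; ring.
rewrite -(ler_pM2l (expR_gt0 (- (s ^+ 2 / 8)))).
rewrite -expRD addNr expR0 mulrC -mulrA -expRD.
rewrite (_ : - (p * s) + - (s ^+ 2 / 8) = - (8^-1 * s ^+ 2 + p * s)) //.
ring.
Qed.

(** Exchanging success and failure turns a negative [s] into a positive one. *)
Lemma bernoulli_mgf p s : 0 <= p <= 1 ->
  p * expR (s * (1 - p)) + (1 - p) * expR (- (s * p)) <= expR (s ^+ 2 / 8).
Proof.
move=> p01; have [s0|s0] := leP 0 s; first exact: bernoulli_mgf_pos.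
have p01' : 0 <= 1 - p <= 1 by lra.
have s0' : 0 <= - s by lra.
have := bernoulli_mgf_pos p01' s0'; rewrite sqrrN.
rewrite (_ : 1 - (1 - p) = p); last by ring.
rewrite (_ : - (- s * (1 - p)) = s * (1 - p)); last by ring.
by rewrite mulNr [X in X <= _ -> _]addrC.
Qed.
End BernoulliMgf.

(** * Real-valued probabilities and decomposition along finite-valued maps *)

Section RealProbability.
Variables (R : realType) (d : measure_display) (T : measurableType d)
  (P : probability T R).
Implicit Types (A B S : set T) (p : R).

Definition pr A : R := fine (P A).

Lemma prE A : measurable A -> P A = (pr A)%:E.
Proof. by move=> mA; rewrite /pr fineK// fin_num_measure. Qed.

Lemma pr_ge0 A : 0 <= pr A.
Proof. by rewrite /pr fine_ge0. Qed.

Lemma pr_le A B : measurable A -> measurable B -> A `<=` B -> pr A <= pr B.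
Proof.
move=> mA mB AB; rewrite -lee_fin -!prE//.
by apply: le_measure => //; rewrite inE.
Qed.

Lemma pr0 : pr set0 = 0.
Proof. by rewrite /pr measure0. Qed.

Lemma prT : pr setT = 1.
Proof. by rewrite /pr probability_setT. Qed.

Lemma pr_setC A : measurable A -> pr (~` A) = 1 - pr A.
Proof. by move=> mA; rewrite /pr probability_setC// prE. Qed.

Lemma pr_split B A : measurable A -> measurable B ->
  pr A = pr (A `&` B) + pr (A `\` B).
Proof.
move=> mA mB; apply: EFin_inj; rewrite EFinD -!prE//; last first.
  exact: measurableI.
  exact: measurableD.
by rewrite addeC -measureDI.
Qed.

Lemma pr_setU A B : measurable A -> measurable B ->
  pr (A `|` B) <= pr A + pr B.
Proof.
move=> mA mB; rewrite -lee_fin EFinD -!prE//; last exact: measurableU.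
exact: measureU2.
Qed.

Lemma pr_bigsetU (I : Type) (r : seq I) (F : I -> set T) :
  (forall i, measurable (F i)) ->
  pr (\big[setU/set0]_(i <- r) F i) <= \sum_(i <- r) pr (F i).
Proof.
move=> mF; elim: r => [|i r IH]; first by rewrite !big_nil pr0.
rewrite !big_cons; apply: le_trans (pr_setU _ _) _ => //.
  exact: bigsetU_measurable.
by rewrite lerD2l.
Qed.

(** Law of total probability over the values of [U]. The induction runs over duplicate-free lists of
    values, so that each added fibre is disjoint from the previous ones. *)
Lemma pr_fin_partition (I : finType) (U : T -> I) A B p :
  (forall v, measurable (U @^-1` [set v])) -> measurable A -> measurable B ->
  (forall v, pr (U @^-1` [set v] `&` A) = p * pr (U @^-1` [set v] `&` B)) ->
  pr A = p * pr B.
Proof.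
move=> mU mA mB h.
have mUs s : measurable [set w | U w \in (s : seq I)].
  elim: s => [|v s IH].
    by rewrite (_ : mkset _ = set0)// -subset0 => w /=.
  rewrite (_ : mkset _ = U @^-1` [set v] `|` [set w | U w \in s]).
    exact: measurableU.
  apply/seteqP; split => w /=; rewrite inE.
    by move=> /orP[/eqP|]; [left|right].
  by move=> [->|->]; rewrite ?eqxx ?orbT.
have key s : uniq s ->
    pr ([set w | U w \in s] `&` A) = p * pr ([set w | U w \in s] `&` B).
  elim: s => [_|v s IH /= /andP[vs us]].
    by rewrite (_ : mkset _ = set0) ?set0I ?pr0 ?mulr0// -subset0 => w /=.
  have E C : measurable C -> pr ([set w | U w \in v :: s] `&` C) =
      pr (U @^-1` [set v] `&` C) + pr ([set w | U w \in s] `&` C).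
    move=> mC; rewrite (pr_split (B := U @^-1` [set v]))//; last first.
      exact: measurableI.
    congr (pr _ + pr _); apply/seteqP; split => w /=.
    - by move=> [[_ ?] ?].
    - by move=> [-> ?]; rewrite inE eqxx.
    - rewrite inE => -[[/orP[/eqP->|//] ?] n] //.
    - by move=> [us' ?]; rewrite inE us' orbT; split=> // E; rewrite E (negbTE vs) in us'.
  by rewrite !E// h IH// mulrDr.
have := key (enum I) (enum_uniq I).
rewrite (_ : mkset _ = setT) ?setTI// -subTset => w /= _.
by rewrite mem_enum.
Qed.

Lemma measurable_saturated (I : finType) (U : T -> I) S :
  (forall v, measurable (U @^-1` [set v])) ->
  (forall w w', U w = U w' -> S w -> S w') -> measurable S.
Proof.
move=> mU hS; rewrite (_ : S = \bigcup_(v in U @` S) U @^-1` [set v]).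
  by apply: fin_bigcup_measurable => //; exact: finite_finset.
apply/seteqP; split => [w Sw|w [v [w' Sw' <-]]] /=.
  by exists (U w) => //; exists w.
by move=> /esym/hS; apply.
Qed.

(** * Histories of finite-valued processes *)

Section History.
Variables (I : finType) (V : nat -> T -> I).
Hypothesis mV : forall n v, measurable (V n @^-1` [set v]).

Definition history n w := [seq V i w | i <- iota 0 n].

Lemma historyS n w : history n.+1 w = rcons (history n w) (V n w).
Proof. by rewrite /history -addn1 iotaD map_cat cats1. Qed.

Lemma measurable_history n u : measurable [set w | history n w = u].
Proof.
elim: n u => [|n IH] u.
  have [->|u0] := eqVneq u [::]; first by rewrite (_ : mkset _ = setT)// -subTset.
  rewrite (_ : mkset _ = set0)// -subset0 => w /= /esym E.
  by rewrite E in u0.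
case/lastP: u => [|u v].
  by rewrite (_ : mkset _ = set0)// -subset0 => w /=; rewrite historyS; case: history.
rewrite (_ : mkset _ = [set w | history n w = u] `&` V n @^-1` [set v]).
  exact: measurableI.
apply/seteqP; split => w /=; rewrite historyS; first by move=> /rcons_inj[-> ->].
by move=> [-> ->].
Qed.

(** Tuples of fixed length form a finite type, as [pr_fin_partition] and [measurable_saturated]
    require; sequences do not. *)
Definition historyt n w : n.-tuple I := [tuple V i w | i < n].

Lemma val_historyt n w : val (historyt n w) = history n w.
Proof. by rewrite /= /history -val_enum_ord -map_comp. Qed.

Lemma measurable_historyt n v : measurable (historyt n @^-1` [set v]).
Proof.
rewrite (_ : _ @^-1` _ = [set w | history n w = v]); first exact: measurable_history.
apply/seteqP; split => w /=; rewrite -val_historyt; first by move=> ->.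
exact: val_inj.
Qed.

(** Set-theoretic form of membership in the sigma-algebra generated by the first [n] values. *)
Definition saturated n S := forall w w', history n w = history n w' -> S w -> S w'.

Lemma measurable_history_saturated n S : saturated n S -> measurable S.
Proof.
move=> hS; apply: (@measurable_saturated _ (historyt n)); first exact: measurable_historyt.
by move=> w w' /(congr1 val); rewrite !val_historyt; exact: hS.
Qed.

(** Conditional laws are given on atoms of the full history; this carries them over to coarser
    events of the past. The product form avoids dividing by null probabilities. *)
Lemma pr_saturated_cond n S E E' p :
  saturated n S -> measurable E -> measurable E' ->
  (forall h, pr ([set w | history n w = h] `&` E') =
    p * pr ([set w | history n w = h] `&` E)) ->
  pr (S `&` E') = p * pr (S `&` E).
Proof.
move=> hS mE mE' h; have mS := measurable_history_saturated hS.
apply: (@pr_fin_partition _ (historyt n)); do ?exact: measurableI.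
  exact: measurable_historyt.
move=> v.
have -> : historyt n @^-1` [set v] = [set w | history n w = v].
  apply/seteqP; split => w /=; rewrite -val_historyt; first by move=> ->.
  exact: val_inj.
(* An atom of the history lies inside [S] or is disjoint from it. *)
have [[w0 [p0 S0]]|no] := pselect (exists w0, history n w0 = v /\ S w0).
  have E1 C : [set w | history n w = v] `&` (S `&` C) = [set w | history n w = v] `&` C.
    apply/seteqP; split => w /= [pw]; first by move=> [_ ?].
    by move=> ?; do !split => //; apply: (hS w0) => //; rewrite p0.
  by rewrite !E1 h.
have E0 C : [set w | history n w = v] `&` (S `&` C) = set0.
  by rewrite -subset0 => w /= [pw [Sw _]]; apply: no; exists w.
by rewrite !E0 pr0 mulr0.
Qed.
End History.
End RealProbability.

(** * Hoeffding's inequality for predictably selected trials *)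

Section SelectedHoeffding.
Variables (R : realType) (d : measure_display) (T : measurableType d)
  (P : probability T R) (a b : nat -> T -> bool) (p : R) (N : nat).
Hypothesis ma : forall n, measurable [set w | a n w].
Hypothesis mb : forall n, measurable [set w | b n w].
Hypothesis p01 : 0 <= p <= 1.

(** Masking the outcomes of unselected trials leaves three symbols per time: skip, failure,
    success. *)
Let V n w := (a n w, a n w && b n w).

Hypothesis cond : forall n u, (n < N)%N ->
  pr P ([set w | history V n w = u] `&` [set w | a n w && b n w]) =
  p * pr P ([set w | history V n w = u] `&` [set w | a n w]).

Let mab n : measurable [set w | a n w && b n w].
Proof.
rewrite (_ : mkset _ = [set w | a n w] `&` [set w | b n w]).
  exact: measurableI.
by apply/seteqP; split => w /= => [/andP[]//|[-> ->]].
Qed.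

Let mV n v : measurable (V n @^-1` [set v]).
Proof.
have mbool (f : T -> bool) e : measurable [set w | f w] -> measurable [set w | f w = e].
  case: e => // /measurableC; congr measurable.
  by apply/seteqP; split => w /=; case: (f w).
case: v => e e'.
rewrite (_ : _ @^-1` _ = [set w | a n w = e] `&` [set w | a n w && b n w = e']).
  by apply: measurableI; exact: mbool.
by apply/seteqP; split => w; rewrite /V /= => -[ea eb]; rewrite ?ea ?eb -?ea -?eb.
Qed.

Let nsel (u : seq (bool * bool)) := count fst u.
Let nsucc (u : seq (bool * bool)) := count snd u.

Let g (s : R) u : R :=
  expR (s * ((nsucc u)%:R - p * (nsel u)%:R) - s ^+ 2 / 8 * (nsel u)%:R).

Let g_skip s u : g s (rcons u (false, false)) = g s u.
Proof. by rewrite /g /nsel /nsucc -cats1 !count_cat /= !addn0. Qed.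

(** The exponential common to all terms factors out; what remains is [bernoulli_mgf] divided by
    exp(s^2/8). *)
Let g_step s u :
  p * g s (rcons u (true, true)) + (1 - p) * g s (rcons u (true, false)) <= g s u.
Proof.
rewrite /g /nsel /nsucc -!cats1 !count_cat /= !addn0 !natrD.
set k := (count snd u)%:R; set c := (count fst u)%:R.
rewrite (_ : s * (k + 1 - p * (c + 1)) - s ^+ 2 / 8 * (c + 1) =
  s * (1 - p) + (- (s ^+ 2 / 8) + (s * (k - p * c) - s ^+ 2 / 8 * c))); last by ring.
rewrite (_ : s * (k - p * (c + 1)) - s ^+ 2 / 8 * (c + 1) =
  - (s * p) + (- (s ^+ 2 / 8) + (s * (k - p * c) - s ^+ 2 / 8 * c))); last by ring.
rewrite !(expRD _ (- (s ^+ 2 / 8) + _)) !mulrA -mulrDl expRD mulrA.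
rewrite -[leRHS]mul1r ler_pM2r ?expR_gt0// (expRN (s ^+ 2 / 8)).
rewrite ler_pdivrMr ?expR_gt0// mul1r.
exact: bernoulli_mgf.
Qed.

(** A negative [s] gives the lower tail, so one argument serves both sides. *)
Let tail (F : nat) (s L : R) := [set w |
  nsel (history V N w) = F /\ L <= s * ((nsucc (history V N w))%:R - p * F%:R)].

Let mtail F s L : measurable (tail F s L).
Proof.
by apply: (measurable_history_saturated mV (n := N)) => w w' E; rewrite /tail /= E.
Qed.

(* Backward induction over the atoms of the history replaces the optional
   stopping argument for the supermartingale [g s (history V n)]. *)
Let tail_atom F s L k n u : (n + k = N)%N ->
  pr P ([set w | history V n w = u] `&` tail F s L) <=
  expR (s ^+ 2 / 8 * F%:R - L) * (pr P [set w | history V n w = u] * g s u).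
Proof.
elim: k n u => [|k IH] n u nk.
  rewrite addn0 in nk; subst n.
  have mh := measurable_history mV N u.
  (* At time [N] the word [u] decides the event. If it occurs, [g s u] is at least exp(L - s^2 F /
     8), which cancels the prefactor; otherwise the intersection is empty. *)
  have [[uF uL]|no] := pselect (nsel u = F /\ L <= s * ((nsucc u)%:R - p * F%:R)).
    apply: (le_trans (pr_le P _ mh _)); [exact: measurableI|exact: subIsetl|].
    rewrite mulrCA ler_peMr ?pr_ge0// /g uF -expRD -[leLHS]expR0 ler_expR.
    move: uL; lra.
  rewrite (_ : _ `&` _ = set0) ?pr0 ?mulr_ge0 ?expR_ge0 ?pr_ge0//.
  by rewrite -subset0 => w /= [hw [? ?]]; apply: no; rewrite -hw.
have nN : (n < N)%N by rewrite -nk -addSnnS leq_addr.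
have nk' : (n.+1 + k = N)%N by rewrite addSnnS.
pose H := [set w | history V n w = u].
pose A := [set w | a n w]; pose B := [set w | a n w && b n w].
have mH : measurable H := measurable_history mV n u.
have mHt := measurableI _ _ mH (mtail F s L).
(* The next symbol splits the atom into success, failure and skip. *)
have E11 : H `&` A `&` B = [set w | history V n.+1 w = rcons u (true, true)].
  apply/seteqP; split => w /=; rewrite historyS.
    by rewrite /H /A /B /= => -[[-> ea] eb]; rewrite /V eb ea.
  by rewrite /H /A /B /= => /rcons_inj[-> ea eb]; rewrite eb ea.
have E10 : (H `&` A) `\` B = [set w | history V n.+1 w = rcons u (true, false)].
  apply/seteqP; split => w /=; rewrite historyS.
    by rewrite /H /A /B /= => -[[-> ea] /negP/negbTE eb]; rewrite /V eb ea.
  by rewrite /H /A /B /= => /rcons_inj[-> ea eb]; rewrite eb ea.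
have E00 : H `\` A = [set w | history V n.+1 w = rcons u (false, false)].
  apply/seteqP; split => w /=; rewrite historyS.
    by rewrite /H /A /= => -[-> /negP/negbTE ea]; rewrite /V ea.
  by rewrite /H /A /= => /rcons_inj[-> ->].
have p1 : pr P (H `&` A `&` B) = p * pr P (H `&` A).
  rewrite -cond//; congr pr; apply/seteqP; split => w /=.
    by move=> [[? ?] ?].
  by rewrite /A /B /= => -[? /andP[-> ->]].
have p2 : pr P ((H `&` A) `\` B) = (1 - p) * pr P (H `&` A).
  have := pr_split P (measurableI _ _ mH (ma n)) (mab n); rewrite p1; lra.
have p3 := pr_split P mH (ma n).
rewrite (pr_split P mHt (ma n)) (pr_split P (measurableI _ _ mHt (ma n)) (mab n)).
rewrite -/H -/A -/B.
have -> : H `&` tail F s L `&` A `&` B = H `&` A `&` B `&` tail F s L.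
  by rewrite -setIA setIAC setIA.
have -> : (H `&` tail F s L `&` A) `\` B = ((H `&` A) `\` B) `&` tail F s L.
  by rewrite !setDE -setIA setIAC setIA.
have -> : (H `&` tail F s L) `\` A = (H `\` A) `&` tail F s L.
  by rewrite !setDE setIAC.
have := IH n.+1 (rcons u (true, true)) nk'.
have := IH n.+1 (rcons u (true, false)) nk'.
have := IH n.+1 (rcons u (false, false)) nk'.
rewrite -E11 -E10 -E00 p1 p2 g_skip p3.
set c := expR _; have c0 : 0 <= c by exact: expR_ge0.
move=> i00 i10 i11.
(* The skipped part keeps its value of [g]. Success and failure carry the shares p and 1 - p of the
   mass of [H] and [A] together, so [g_step] bounds their mixture. *)
have := ler_wpM2l (mulr_ge0 c0 (pr_ge0 P (H `&` A))) (g_step s u).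
rewrite -/A; move: i00 i10 i11; lra.
Qed.

Let tail_bound F s L : pr P (tail F s L) <= expR (s ^+ 2 / 8 * F%:R - L).
Proof.
have := @tail_atom F s L N 0%N [::] (add0n N).
rewrite (_ : [set w | _] = setT) ?setTI ?prT; last by rewrite -subTset.
by rewrite /g /nsel /nsucc /= !mulr0 subrr mulr0 subr0 expR0 !mulr1.
Qed.

Lemma selected_hoeffding (F : nat) (t : R) : 0 <= t ->
  pr P [set w | count (a ^~ w) (iota 0 N) = F /\
    F%:R * t <= `|(count (fun i => a i w && b i w) (iota 0 N))%:R - p * F%:R| ]
  <= 2 * expR (- (2 * F%:R * t ^+ 2)).
Proof.
(* The value s = 4t minimises s^2 F / 8 - s F t, with minimum -2 F t^2; the lower tail uses s =
   -4t. *)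
move=> t0; pose tp := tail F (4 * t) (4 * t * (F%:R * t)).
pose tm := tail F (- (4 * t)) (4 * t * (F%:R * t)).
have sub : [set w | count (a ^~ w) (iota 0 N) = F /\
    F%:R * t <= `|(count (fun i => a i w && b i w) (iota 0 N))%:R - p * F%:R| ]
    `<=` tp `|` tm.
  move=> w /= [cF]; rewrite ler_normr => /orP[h|h]; [left|right].
    split; first by rewrite /nsel /history count_map.
    by rewrite /nsucc /history count_map ler_wpM2l// mulr_ge0.
  split; first by rewrite /nsel /history count_map.
  by rewrite /nsucc /history count_map mulNr -mulrN ler_wpM2l// mulr_ge0.
apply: (le_trans (pr_le P _ _ sub)).
  apply: (measurable_history_saturated mV (n := N)) => w w' E /=.
  have c1 v : count (a ^~ v) (iota 0 N) = nsel (history V N v).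
    by rewrite /nsel /history count_map.
  have c2 v : count (fun i => a i v && b i v) (iota 0 N) = nsucc (history V N v).
    by rewrite /nsucc /history count_map.
  by rewrite !c1 !c2 E.
  by apply: measurableU; exact: mtail.
apply: (le_trans (pr_setU P (mtail _ _ _) (mtail _ _ _))).
have := tail_bound F (4 * t) (4 * t * (F%:R * t)).
have := tail_bound F (- (4 * t)) (4 * t * (F%:R * t)).
rewrite -/tp -/tm sqrrN.
rewrite (_ : _ - _ = - (2 * F%:R * t ^+ 2)); last by field.
lra.
Qed.
End SelectedHoeffding.

(* The bound [33 / 20] exceeds [pi ^ 2 / 6] by less than [0.006]; the tail is
   compared with [1 / (k ^ 2 - 1 / 4)], which telescopes. *)
Lemma sum_inv_sq_le (R : realFieldType) n :
  \sum_(k < n) (k.+1%:R ^+ 2)^-1 <= 33 / 20 :> R.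
Proof.
have tele m : \sum_(k < m.+2) (k.+1%:R ^+ 2)^-1 <= 33 / 20 - (m%:R + 5 / 2)^-1 :> R.
  elim: m => [|m IH].
    (* Equality holds here: the first two terms 1 + 1/4 and the telescoped tail 2/5 add up to
       exactly 33/20. *)
    rewrite !big_ord_recr big_ord0 /= expr1n invr1 add0r.
    rewrite (_ : (2 ^+ 2)^-1 = 1 / 4 :> R); last by field.
    rewrite (_ : (0 + 5 / 2)^-1 = 2 / 5 :> R); [lra|by field].
  rewrite big_ord_recr /= (le_trans (lerD IH (lexx _)))//.
  have m0 : (0 : R) <= m%:R by [].
  have -> : m.+3%:R = m%:R + 3 :> R by rewrite -natrD addn3.
  rewrite -(natr1 m); set x := m%:R in m0 *.
  have shift (r u v t : R) : t <= u - v -> r - u + t <= r - v by lra.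
  apply: shift.
  have -> : (x + 5 / 2)^-1 - (x + 1 + 5 / 2)^-1 = ((x + 3) ^+ 2 - 1 / 4)^-1.
    by field; do !(apply/andP; split); apply/eqP; nra.
  by rewrite lef_pV2 ?posrE; nra.
case: n => [|[|n]]; first by rewrite big_ord0; lra.
  by rewrite big_ord_recr big_ord0 /= expr1n invr1; lra.
apply: le_trans (tele n) _.
have : 0 <= ((n%:R : R) + 5 / 2)^-1 by rewrite invr_ge0 addr_ge0.
lra.
Qed.

(** The threshold t solves 2 F t^2 = ln c; [1 <= c] keeps ln c nonnegative, so that the square root
    squares back to its argument. *)
Lemma selected_hoeffding_confidence (R : realType) (d : measure_display)
  (T : measurableType d) (P : probability T R) (a b : nat -> T -> bool) (p : R)
  (N F : nat) (c : R) :
  (forall n, measurable [set w | a n w]) ->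
  (forall n, measurable [set w | b n w]) ->
  0 <= p <= 1 ->
  (forall n u, (n < N)%N ->
    pr P ([set w | history (fun n w => (a n w, a n w && b n w)) n w = u]
          `&` [set w | a n w && b n w]) =
    p * pr P ([set w | history (fun n w => (a n w, a n w && b n w)) n w = u]
          `&` [set w | a n w])) ->
  (0 < F)%N -> 1 <= c ->
  pr P [set w | count (a ^~ w) (iota 0 N) = F /\
    F%:R * Num.sqrt (ln c / (2 * F%:R)) <=
    `|(count (fun i => a i w && b i w) (iota 0 N))%:R - p * F%:R| ]
  <= 2 / c.
Proof.
move=> ma mb p01 cond F0 c1.
apply: (le_trans (selected_hoeffding ma mb p01 cond F (sqrtr_ge0 _))).
rewrite sqr_sqrtr; last by rewrite divr_ge0 ?ln_ge0// mulr_ge0.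
have F0' : (F%:R : R) != 0 by rewrite pnatr_eq0 -lt0n.
rewrite (_ : 2 * F%:R * (ln c / (2 * F%:R)) = ln c); last by field.
by rewrite expRN lnK ?posrE// (lt_le_trans _ c1).
Qed.

(** * Counting visits and truncating their number to a power of two *)

Section Counting.
Variables (T : Type) (Xt Yt Zt : finType).
Variables (X : nat -> T -> Xt) (Y : nat -> T -> Yt) (Z : nat -> T -> Zt).
Implicit Types (x : Xt) (y : Yt) (z : Zt).

Lemma cntXZ_S n x z w :
  cntXZ X Z n.+1 x z w = (cntXZ X Z n x z w + ((X n w == x) && (Z n w == z)))%N.
Proof. by rewrite /cntXZ -addn1 iotaD count_cat /= addn0. Qed.

Lemma cntXZ_le n x z w : (cntXZ X Z n x z w <= n)%N.
Proof. by rewrite /cntXZ (leq_trans (count_size _ _))// size_iota. Qed.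

(** The strict bound concerns the visits before time [i], so selection depends on the past and on
    X_i, Z_i, but not on Y_i. *)
Definition first_visits (F : nat) x z i w :=
  [&& X i w == x, Z i w == z & (cntXZ X Z i x z w < F)%N].

Lemma count_first_visits F x z n w :
  count (fun i => first_visits F x z i w) (iota 0 n) = minn F (cntXZ X Z n x z w).
Proof.
elim: n => [|n IH]; first by rewrite /cntXZ /= minn0.
rewrite -addn1 iotaD count_cat IH /= addn0 add0n addn1 cntXZ_S /first_visits.
by case: (X n w == x); case: (Z n w == z) => /=; lia.
Qed.

(** The exponent is at least 1, hence the form [k.+1]; [k < n] later places [k] among the [N]
    indices of the union bound. *)
Lemma dfloorE n : (2 <= n)%N ->
  exists k, [/\ dfloor n = (2 ^ k.+1)%N, (2 ^ k.+1 <= n)%N & (k < n)%N].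
Proof.
move=> n2; exists (trunc_log 2 n).-1.
have k0 : (0 < trunc_log 2 n)%N by rewrite trunc_log_gt0.
have le : (2 ^ trunc_log 2 n <= n)%N by rewrite trunc_logP// (leq_trans _ n2).
rewrite /dfloor ltnNge n2 /= prednK//; split => //.
have := @ltn_expl 2 (trunc_log 2 n) isT; lia.
Qed.

Lemma pcheckE (R : realType) N y x z w (F := dfloor (cntXZ X Z N x z w)) :
  pcheck R X Y Z N y x z w =
  (count (fun i => first_visits F x z i w && (Y i w == y)) (iota 0 N))%:R / F%:R.
Proof.
rewrite /pcheck -/F; congr (_%:R / _); apply: eq_count => i /=.
(* The count in [pcheck] includes visit [i] itself, so at a visit its bound [<= F] is the strict
   bound of [first_visits]. *)
rewrite cntXZ_S /first_visits.
by case: (X i w == x); case: (Z i w == z); case: (Y i w == y);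
  rewrite /= ?andbF ?addn1 ?andbT.
Qed.
End Counting.

Lemma ratio_deviation (R : realFieldType) (k F p t : R) : 0 < F ->
  ~ (F * t <= `|k - p * F|) -> `|k / F - p| <= t.
Proof.
move=> F0 /negP; rewrite -ltNge => /ltW h.
have F0' : F != 0 by rewrite gt_eqF.
rewrite (_ : k / F - p = (k - p * F) / F); last by field.
by rewrite normrM normfV (gtr0_norm F0) ler_pdivrMr// (mulrC t).
Qed.

(** * Bad events and coverage of the back-door estimate *)

Section BackDoor.
Variables (R : realType) (d : measure_display) (T : measurableType d)
  (P : probability T R) (Xt Yt Zt : finType) (N : nat)
  (X : nat -> T -> Xt) (Y : nat -> T -> Yt) (Z : nat -> T -> Zt)
  (pi : Zt -> R) (q : Xt -> Zt -> Yt -> R).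
Hypothesis mX : forall n a, measurable (X n @^-1` [set a]).
Hypothesis mY : forall n b, measurable (Y n @^-1` [set b]).
Hypothesis mZ : forall n c, measurable (Z n @^-1` [set c]).
Hypothesis pi_ge0 : forall z, 0 <= pi z.
Hypothesis pi_sum : \sum_(z : Zt) pi z = 1.
Hypothesis q_ge0 : forall x z b, 0 <= q x z b.
Hypothesis q_sum : forall x z, \sum_(b : Yt) q x z b = 1.
Hypothesis condZ : forall n h z, (n < N)%N ->
  P [set w | hist X Y Z n w = h /\ Z n w = z] =
  ((pi z)%:E * P [set w | hist X Y Z n w = h])%E.
Hypothesis condY : forall n h z x b, (n < N)%N ->
  P [set w | hist X Y Z n w = h /\ Z n w = z /\ X n w = x /\ Y n w = b] =
  ((q x z b)%:E * P [set w | hist X Y Z n w = h /\ Z n w = z /\ X n w = x])%E.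

Let W n w := (X n w, Y n w, Z n w).

Let mXb n x : measurable [set w | X n w == x].
Proof.
rewrite (_ : mkset _ = X n @^-1` [set x])//.
by apply/seteqP; split => w /= => [/eqP|->].
Qed.

Let mYb n y : measurable [set w | Y n w == y].
Proof.
rewrite (_ : mkset _ = Y n @^-1` [set y])//.
by apply/seteqP; split => w /= => [/eqP|->].
Qed.

Let mZb n z : measurable [set w | Z n w == z].
Proof.
rewrite (_ : mkset _ = Z n @^-1` [set z])//.
by apply/seteqP; split => w /= => [/eqP|->].
Qed.

Let mW n v : measurable (W n @^-1` [set v]).
Proof.
case: v => [[x y] z].
rewrite (_ : _ @^-1` _ =
  X n @^-1` [set x] `&` (Y n @^-1` [set y]) `&` (Z n @^-1` [set z])).
  by do 2?apply: measurableI.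
by apply/seteqP; split => w; rewrite /W /=; [move=> [-> -> ->]|move=> [[-> ->] ->]].
Qed.

Let history_eq n w w' : history W n w = history W n w' ->
  forall i, (i < n)%N -> [/\ X i w = X i w', Y i w = Y i w' & Z i w = Z i w'].
Proof.
move=> /eq_in_map h i lt; have : i \in iota 0 n by rewrite mem_iota.
by move=> /h [].
Qed.

Let cntXZ_history n m x z w w' : (m <= n)%N -> history W n w = history W n w' ->
  cntXZ X Z m x z w = cntXZ X Z m x z w'.
Proof.
move=> mn /history_eq h; apply: eq_in_count => i; rewrite mem_iota /= => im.
by have [-> _ ->] := h i (leq_trans im mn).
Qed.

Let cntZ_history n z w w' : history W n w = history W n w' ->
  cntZ Z n z w = cntZ Z n z w'.
Proof.
move=> /history_eq h; apply: eq_in_count => i; rewrite mem_iota /= => im.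
by have [_ _ ->] := h i im.
Qed.

Let first_visits_history n F x z w w' : history W n w = history W n w' ->
  forall i, (i < n)%N -> first_visits X Z F x z i w = first_visits X Z F x z i w'.
Proof.
move=> h i lt; have [eX _ eZ] := history_eq h lt.
by rewrite /first_visits eX eZ (cntXZ_history _ _ (ltnW lt) h).
Qed.

Let first_successes_history n F x y z w w' : history W n w = history W n w' ->
  count (fun i => first_visits X Z F x z i w && (Y i w == y)) (iota 0 n) =
  count (fun i => first_visits X Z F x z i w' && (Y i w' == y)) (iota 0 n).
Proof.
move=> h; apply: eq_in_count => i; rewrite mem_iota /= => im.
by have [_ -> _] := history_eq h im; rewrite (first_visits_history _ _ _ h im).
Qed.

(** The first [N] observations determine the counts and both estimates, so the event is a finite
    union of atoms of the history. *)
Lemma measurable_covered (delta Pdo : R) y x :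
  measurable [set w | covered X Y Z N delta Pdo y x w].
Proof.
apply: (measurable_history_saturated mW (n := N)) => w w' h.
have eXZ z := cntXZ_history x z (leqnn N) h.
have em : m_est R X Y Z N y x w = m_est R X Y Z N y x w'.
  apply: eq_bigr => z _; congr (_ * _); first by rewrite /phat (cntZ_history z h).
  by rewrite !pcheckE eXZ (first_successes_history _ _ _ _ h).
have eh : h_est X Z N delta x w = h_est X Z N delta x w'.
  by congr (_ + _); apply: eq_bigr => z _; rewrite eXZ.
rewrite /covered /= em eh => H c; apply: H => z; rewrite eXZ; exact: c.
Qed.

Let pi_01 z : 0 <= pi z <= 1.
Proof.
rewrite pi_ge0 /= -pi_sum (bigD1 z)//= lerDl sumr_ge0//.
Qed.

Let q_01 x z y : 0 <= q x z y <= 1.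
Proof.
rewrite q_ge0 /= -(q_sum x z) (bigD1 y)//= lerDl sumr_ge0//.
Qed.

Let bad_pi (c : R) z := [set w |
  N%:R * Num.sqrt (ln c / (2 * N%:R)) <= `|(cntZ Z N z w)%:R - pi z * N%:R| ].

Let measurable_bad_pi c z : measurable (bad_pi c z).
Proof.
apply: (measurable_history_saturated mW (n := N)) => w w' h.
by rewrite /bad_pi /= (cntZ_history z h).
Qed.

Lemma pr_bad_pi c z : (0 < N)%N -> 1 <= c -> pr P (bad_pi c z) <= 2 / c.
Proof.
move=> N0 c1.
(* Every time is selected, so the number of trials is the constant [N]. *)
pose a (n : nat) (w : T) := true; pose b n w := Z n w == z.
have ma n : measurable [set w | a n w].
  by rewrite (_ : mkset _ = setT)// -subTset.
have := @selected_hoeffding_confidence _ _ _ P a b (pi z) N N c ma (mZb ^~ z) (pi_01 z).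
rewrite (_ : [set w | _] = bad_pi c z); last first.
  apply/seteqP; split => w /=; rewrite count_predT size_iota; first by case.
  by move=> ?; split.
apply=> // n u nN.
have -> : [set w | a n w] = setT by rewrite -subTset.
(* The masked record is a function of the full history, so its atoms are saturated. *)
apply: (pr_saturated_cond mW (n := n)) => //.
- move=> w w' h /= <-; apply/esym/eq_in_map => i; rewrite mem_iota /= => ni.
  by rewrite /a /b; have [_ _ ->] := history_eq h ni.
- exact: (mZb n z).
move=> h; have mh := measurable_history mW n h.
have := condZ h z nN.
rewrite (_ : [set w | _ /\ _] =
  [set w | history W n w = h] `&` [set w | a n w && b n w]).
  rewrite !prE//; first by rewrite setIT => -[].
  by apply: measurableI => //; exact: (mZb n z).
by apply/seteqP; split => w /= [? /eqP].
Qed.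

(** [F] is deterministic here; by [count_first_visits] the first conjunct says that at least [F]
    visits took place. *)
Let bad_q (c : R) F x y z := [set w |
  count (fun i => first_visits X Z F x z i w) (iota 0 N) = F /\
  F%:R * Num.sqrt (ln c / (2 * F%:R)) <=
  `|(count (fun i => first_visits X Z F x z i w && (Y i w == y)) (iota 0 N))%:R
    - q x z y * F%:R| ].

Let measurable_bad_q c F x y z : measurable (bad_q c F x y z).
Proof.
apply: (measurable_history_saturated mW (n := N)) => w w' h.
by rewrite /bad_q /= (first_successes_history _ _ _ _ h) !count_first_visits
  (cntXZ_history _ _ (leqnn N) h).
Qed.

(** Selection at time n means [S n], known from the past, together with [E n], which fixes X_n and
    Z_n. As [condY] conditions on X_n too, the law by which X_n is chosen never enters. *)
Lemma pr_bad_q c F x y z : (0 < F)%N -> 1 <= c -> pr P (bad_q c F x y z) <= 2 / c.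
Proof.
move=> F0 c1.
pose a := first_visits X Z F x z; pose b n w := Y n w == y.
pose S n := [set w | (cntXZ X Z n x z w < F)%N].
pose E n := [set w | X n w == x] `&` [set w | Z n w == z].
have mE n : measurable (E n) by apply: measurableI.
have aE n : [set w | a n w] = S n `&` E n.
  apply/seteqP; split => w; rewrite /S /E /a /first_visits /=.
    by move=> /and3P[].
  by move=> [-> [-> ->]].
have sS n : saturated W n (S n).
  by move=> w w' h; rewrite /S /= (cntXZ_history _ _ (leqnn n) h).
have ma n : measurable [set w | a n w].
  rewrite aE; apply: measurableI => //; exact: (measurable_history_saturated mW (sS n)).
apply: (selected_hoeffding_confidence (a := a) (b := b)) => //.
  by move=> n; exact: (mYb n y).
move=> n u nN; set H := [set w | _ = u].
have -> : H `&` [set w | a n w] = (H `&` S n) `&` E n by rewrite aE setIA.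
have -> : H `&` [set w | a n w && b n w] =
    (H `&` S n) `&` (E n `&` [set w | Y n w == y]).
  rewrite -setIA; congr (_ `&` _); rewrite setIA -aE.
  by apply/seteqP; split => w /= => [/andP|/andP].
apply: (pr_saturated_cond mW (n := n)) => //.
- move=> w w' h [Hw Sw]; split; last exact: sS h Sw.
  rewrite /H /= -Hw; apply/esym/eq_in_map => i; rewrite mem_iota /= => ni.
  rewrite /a /b (first_visits_history _ _ _ h ni).
  by have [_ -> _] := history_eq h ni.
- by apply: measurableI.
move=> h; have mh := measurable_history mW n h.
have := condY h z x y nN.
rewrite (_ : [set w | _ /\ _ /\ _ /\ _] =
  [set w | history W n w = h] `&` (E n `&` [set w | Y n w == y])).
rewrite (_ : [set w | _ /\ _ /\ _] = [set w | history W n w = h] `&` E n).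
- have mEY : measurable (E n `&` [set w | Y n w == y]) by apply: measurableI.
  by rewrite !prE; [case|exact: measurableI|exact: measurableI].
- apply/seteqP; split => w; rewrite /E /=; first by move=> [? [-> ->]]; rewrite !eqxx.
  by move=> [? [/eqP-> /eqP->]].
- apply/seteqP; split => w; rewrite /E /=; first by move=> [? [-> [-> ->]]]; rewrite !eqxx.
  by move=> [? [[/eqP-> /eqP->] /eqP->]].
Qed.

Lemma covered_off_bad (c c' delta : R) x y w : 0 < delta < 1 -> (0 < N)%N ->
  (0 < #|Zt|)%N -> c = 4 * #|Zt|%:R / delta -> c' = 66 / 10 * #|Zt|%:R / delta ->
  (forall z, ~ bad_pi c z w) ->
  (forall z (k : 'I_N), ~ bad_q (k.+1%:R ^+ 2 * c') (2 ^ k.+1) x y z w) ->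
  covered X Y Z N delta (\sum_(z : Zt) q x z y * pi z) y x w.
Proof.
move=> /andP[d0 d1] N0 Z0 cE c'E hpi hq visits.
have N0' : 0 < N%:R :> R by rewrite ltr0n.
have c'0 : 0 < c' by rewrite c'E divr_gt0// mulr_gt0 ?ltr0n//; lra.
suff : `|m_est R X Y Z N y x w - \sum_(z : Zt) q x z y * pi z| <=
    h_est X Z N delta x w.
  by rewrite ler_norml; lra.
rewrite /m_est -sumrB; apply: (le_trans (ler_norm_sum _ _ _)).
rewrite /h_est mulr_natl -sumr_const -big_split /=; apply: ler_sum => z _.
rewrite (_ : _ - _ = (phat R Z N z w - pi z) * q x z y +
   phat R Z N z w * (pcheck R X Y Z N y x z w - q x z y)); last by ring.
apply: (le_trans (ler_normD _ _)).
rewrite (normrM (_ - _)) (normrM (phat _ _ _ _ _)); apply: lerD.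
  (* The weights [q] here and [phat] below are at most 1 and are dropped, which is why the radius
     carries no weights. *)
  have /andP[q0 q1] := q_01 x z y; rewrite (ger0_norm q0).
  apply: (@le_trans _ _ (`|phat R Z N z w - pi z|)); first by rewrite ler_piMr.
  by apply: ratio_deviation => //; rewrite -cE; exact: hpi.
have phat01 : 0 <= phat R Z N z w <= 1.
  rewrite divr_ge0//= ler_pdivrMr// mul1r ler_nat /cntZ.
  by rewrite (leq_trans (count_size _ _))// size_iota.
have /andP[h0 h1] := phat01; rewrite (ger0_norm h0).
apply: (@le_trans _ _ (`|pcheck R X Y Z N y x z w - q x z y|));
  first by rewrite ler_piMl.
rewrite pcheckE.
have [k [FE Fle kn]] := dfloorE (visits z).
have kN : (k < N)%N by apply: (leq_trans kn); exact: cntXZ_le.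
rewrite FE; have := hq z (Ordinal kN); rewrite /bad_q /=.
rewrite count_first_visits (minn_idPl Fle).
set F := (2 ^ k.+1)%N; have F0' : 0 < F%:R :> R by rewrite ltr0n expn_gt0.
move=> h; apply: ratio_deviation => //.
(* As log2 F = k + 1, the level (k + 1)^2 c' has logarithm 2 ln log2 F + ln c', the numerator in
   [h_est]. *)
have -> : ln F%:R / ln 2 = k.+1%:R :> R.
  by rewrite /F natrX lnXn// -[ln 2 *+ _]mulr_natl mulfK// gt_eqF// ln_gt0// ltr1n.
rewrite lnM ?posrE ?exprn_gt0// lnXn// -[ln _ *+ 2]mulr_natl c'E in h.
by move=> ?; apply: h.
Qed.

Lemma pr_covered_ge (delta : R) x y : 0 < delta < 1 -> (0 < N)%N -> (0 < #|Zt|)%N ->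
  1 - delta <= pr P [set w |
    covered X Y Z N delta (\sum_(z : Zt) q x z y * pi z) y x w].
Proof.
move=> d01 N0 Z0; have /andP[d0 d1] := d01.
have Z1 : 1 <= #|Zt|%:R :> R by rewrite ler1n.
have Zn0 : #|Zt|%:R != 0 :> R by rewrite pnatr_eq0 -lt0n.
have dn0 : delta != 0 by rewrite gt_eqF.
(* For each z, [bad_pi] costs 2 / c = delta / (2 |Z|). The events [bad_q] summed over k cost (33/20)
   (2 / c'), the same amount because 6.6 = 4 (33/20). *)
pose c : R := 4 * #|Zt|%:R / delta; pose c' : R := 66 / 10 * #|Zt|%:R / delta.
have c1 : 1 <= c by rewrite ler_pdivlMr//; lra.
have c'1 : 1 <= c' by rewrite ler_pdivlMr//; lra.
pose B1 z := bad_pi c z.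
pose B2 z := \big[setU/set0]_(k <- enum 'I_N)
  bad_q (k.+1%:R ^+ 2 * c') (2 ^ k.+1) x y z.
pose B := \big[setU/set0]_(z <- enum Zt) (B1 z `|` B2 z).
have mB2 z : measurable (B2 z).
  by apply: bigsetU_measurable => k _; exact: measurable_bad_q.
have mB12 z : measurable (B1 z `|` B2 z).
  by apply: measurableU => //; exact: measurable_bad_pi.
have mB : measurable B by apply: bigsetU_measurable => z _; exact: mB12.
have prB2 z : pr P (B2 z) <= 33 / 20 * (2 / c').
  apply: (le_trans (pr_bigsetU P _ _)); first by move=> k.
  apply: le_trans (ler_wpM2r _ (sum_inv_sq_le R N)); last first.
    by rewrite divr_ge0// ltW// (lt_le_trans _ c'1).
  rewrite mulr_suml big_enum /=; apply: ler_sum => k _.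
  rewrite [leRHS]mulrCA -invfM; apply: pr_bad_q; first by rewrite expn_gt0.
  by apply: mulr_ege1 => //; rewrite exprn_ege1// ler1n.
have prB : pr P B <= delta.
  apply: (le_trans (pr_bigsetU P _ _)) => //.
  apply: (@le_trans _ _ (\sum_(z <- enum Zt) delta / #|Zt|%:R)).
    apply: ler_sum => z _; apply: (le_trans (pr_setU P (measurable_bad_pi c z) (mB2 z))).
    apply: (le_trans (lerD (pr_bad_pi z N0 c1) (prB2 z))).
    rewrite /c /c' le_eqVlt; apply/orP; left; apply/eqP; field.
    by rewrite Zn0 dn0.
  by rewrite big_enum /= sumr_const -[leLHS]mulr_natr divfK.
apply: (@le_trans _ _ (pr P (~` B))); first by rewrite pr_setC// lerD2l lerN2.
apply: pr_le; [exact: measurableC|exact: measurable_covered|] => w Bw.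
have noB z : ~ (B1 z `|` B2 z) w.
  move=> Bz; apply: Bw; rewrite /B -bigcup_seq; exists z => //=.
  by rewrite mem_enum.
apply: (covered_off_bad (c := c) (c' := c')) => //.
  by move=> z bz; apply: (noB z); left.
move=> z k bz; apply: (noB z); right; rewrite /B2 -bigcup_seq; exists k => //=.
by rewrite mem_enum.
Qed.

End BackDoor.

Theorem theorem3 (R : realType) (d : measure_display) (T : measurableType d)
  (P : probability T R) (Xt Yt Zt : finType) (N : nat)
  (X : nat -> T -> Xt) (Y : nat -> T -> Yt) (Z : nat -> T -> Zt)
  (pi : Zt -> R) (q : Xt -> Zt -> Yt -> R)
  (delta : R) (xt : Xt) (y : Yt) :
  (0 < #|Xt|)%N -> (0 < #|Yt|)%N -> (0 < #|Zt|)%N -> (1 <= N)%N ->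
  (* random elements: measurable maps into the finite sets *)
  (forall n a, measurable (X n @^-1` [set a])) ->
  (forall n b, measurable (Y n @^-1` [set b])) ->
  (forall n c, measurable (Z n @^-1` [set c])) ->
  (* pi and q(.|x,z) are probability distributions *)
  (forall z, 0 <= pi z) -> \sum_(z : Zt) pi z = 1 ->
  (forall x z b, 0 <= q x z b) -> (forall x z, \sum_(b : Yt) q x z b = 1) ->
  (* (i) given H_{n-1}, Z_n ~ pi *)
  (forall n h z, (n < N)%N ->
     P [set w | hist X Y Z n w = h /\ Z n w = z] =
     ((pi z)%:E * P [set w | hist X Y Z n w = h])%E) ->
  (* (iii) given H_{n-1}, Z_n, X_n, Y_n ~ q(. | X_n, Z_n) *)
  (forall n h z x b, (n < N)%N ->
     P [set w | hist X Y Z n w = h /\ Z n w = z /\ X n w = x /\ Y n w = b] =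
     ((q x z b)%:E * P [set w | hist X Y Z n w = h /\ Z n w = z /\ X n w = x])%E) ->
  0 < delta ->
  ((1 - delta)%:E <=
     P [set w | covered X Y Z N delta (\sum_(z : Zt) q xt z y * pi z) y xt w])%E.
Proof.
move=> _ _ Z0 N0 mX mY mZ pi0 pi1 q0 q1 condZ condY d0.
rewrite prE; last exact: measurable_covered.
(* For delta >= 1 the bound is trivial; delta < 1 makes both confidence levels 4 |Z| / delta and 6.6
   |Z| / delta at least 1. *)
rewrite lee_fin; have [d1|d1] := ltP delta 1; last first.
  by apply: le_trans (pr_ge0 _ _); rewrite subr_le0.
by apply: pr_covered_ge => //; rewrite d0.
Qed.
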